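(* Let $p$ be an odd prime. If the $R$-module $M$ is a Bousfield module, then the $R$-action on $M$ extends uniquely to an $A$-action (along $R\subset A$) making $M$ a discrete $A$-module.
   Context: $\mathbb{Z}_{(p)}$ denotes the $p$-local integers. $A$ is the ring of degree zero stable operations in $p$-local complex $K$-theory. Fix $q$ primitive mod $p^2$, $\Psi^q\in A$ the Adams operation, $q_i=q^{(-1)^i\lfloor i/2\rfloor}$, $\Theta_n(X)=\prod_{i=1}^n(X-q_i)$, $\Phi_n=\Theta_n(\Psi^q)$; every element of $A$ is uniquely a convergent sum $\sum_{n\ge0}a_n\Phi_n$ with $a_n\in\mathbb{Z}_{(p)}$, and $A_m=\{\sum_{n\ge m}a_n\Phi_n\}$. An $A$-module $M$ is discrete if each $x\in M$ satisfies $A_nx=0$ for some $n$. Let $R=\mathbb{Z}_{(p)}[\mathbb{Z}_{(p)}^\times]$, writing $\Psi^j$ for $j\in\mathbb{Z}_{(p)}^\times$; mapping $\Psi^j$ to the Adams operation $\Psi^j\in A$ gives $R\subset A$. A Bousfield module is an $R$-module $M$ such that for each $x\in M$: (a) $Rx$ is finitely generated over $\mathbb{Z}_{(p)}$; (b) for each $j\in\mathbb{Z}_{(p)}^\times$, $\Psi^j$ acts on $Rx\otimes\mathbb{Q}$ by a diagonalisable matrix whose eigenvalues are integer powers of $j$; (c) for each $m\ge1$ the action of $\mathbb{Z}_{(p)}^\times$ on $Rx/p^mRx$ factors through $\mathbb{Z}_{(p)}^\times\to(\mathbb{Z}/p^k\mathbb{Z})^\times$ for sufficiently large $k$. *)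

(* Defs.v *)
From HB Require Import structures.
From mathcomp Require Import all_boot all_order all_algebra.
From mathcomp Require Import ring.
Set Implicit Arguments. Unset Strict Implicit. Unset Printing Implicit Defensive.
Import Order.TTheory GRing.Theory Num.Theory.
Local Open Scope ring_scope.

Definition zploc (p : nat) : {pred rat} := fun x => coprime p `|denq x|.

Lemma denq_divz (n d : int) : d != 0 -> (denq (n%:Q / d%:Q) %| d)%Z.
Proof.
move=> d0; case: divqP => [dz|k x _]; first by rewrite dz eqxx in d0.
exact: dvdz_mull.
Qed.

Lemma zploc_frac p (n d : int) : d != 0 -> coprime p `|d| ->
  n%:Q / d%:Q \in zploc p.
Proof.
move=> d0 cd; rewrite unfold_in /zploc.
apply: coprime_dvdr cd; exact: (denq_divz n d0).
Qed.

Lemma zploc_subring p : subring_closed (zploc p).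
Proof.
have cM (x y : rat) : x \in zploc p -> y \in zploc p ->
    coprime p `|denq x * denq y|.
  by rewrite !unfold_in /zploc abszM => cx cy; rewrite coprimeMr cx cy.
have dn (x : rat) : denq x != 0 by rewrite denq_neq0.
split.
- by rewrite unfold_in /zploc /= coprimen1.
- move=> x y Hx Hy.
  have -> : x - y = (numq x * denq y - numq y * denq x)%:Q / (denq x * denq y)%:Q.
    rewrite -{1}[x]divq_num_den -{1}[y]divq_num_den.
    rewrite !rmorphB !rmorphM /=.
    have hx : (denq x)%:Q != 0 by rewrite intr_eq0 denq_neq0.
    have hy : (denq y)%:Q != 0 by rewrite intr_eq0 denq_neq0.
    by field; rewrite hx hy.
  by apply: zploc_frac; [rewrite mulf_neq0 | exact: cM].
- move=> x y Hx Hy.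
  have -> : x * y = (numq x * numq y)%:Q / (denq x * denq y)%:Q.
    rewrite -{1}[x]divq_num_den -{1}[y]divq_num_den !rmorphM /=.
    by rewrite mulrACA invfM.
  by apply: zploc_frac; [rewrite mulf_neq0 | exact: cM].
Qed.

HB.instance Definition _ p :=
  GRing.isSubringClosed.Build rat (zploc p) (zploc_subring p).

Record Zpl (p : nat) := ZplMk { zval : rat; zvalP : zval \in zploc p }.
HB.instance Definition _ p := [isSub for @zval p].
HB.instance Definition _ p := [Choice of Zpl p by <:].
HB.instance Definition _ p := [SubChoice_isSubComNzRing of Zpl p by <:].

(* the element of Z_(p) represented by a rational (0 if it is not p-local) *)
Definition toZpl p (x : rat) : Zpl p := insubd 0 x.

Definition zpunit (p : nat) (j : rat) : bool :=
  [&& j != 0, j \in zploc p & j^-1 \in zploc p].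

(* ---------- R-modules, R = Z_(p)[Z_(p)^x] ---------- *)

(* An R-module: a Z_(p)-module M with Z_(p)-linear operators psi j
   (j a unit of Z_(p)) forming an action of the group Z_(p)^x. *)
Definition is_Rmodule p (M : lmodType (Zpl p)) (psi : rat -> M -> M) : Prop :=
  [/\ (forall j, zpunit p j -> forall (a : Zpl p) (x y : M),
          psi j (a *: x + y) = a *: psi j x + psi j y),
      (forall x, psi 1 x = x) &
      (forall j1 j2, zpunit p j1 -> zpunit p j2 -> forall x,
          psi (j1 * j2) x = psi j1 (psi j2 x))].

Definition inRx p (M : lmodType (Zpl p)) (psi : rat -> M -> M) (x y : M) : Prop :=
  exists s : seq (rat * Zpl p), all (fun u => zpunit p u.1) s /\
    y = \sum_(u <- s) u.2 *: psi u.1 x.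

Definition in_zspan p (M : lmodType (Zpl p)) (s : seq M) (y : M) : Prop :=
  exists c : nat -> Zpl p, y = \sum_(i < size s) c i *: s`_i.

(* torsion elements (their image in Rx (x) Q is zero) *)
Definition torsion p (M : lmodType (Zpl p)) (y : M) : Prop :=
  exists n : nat, (0 < n)%N /\ n%:R *: y = 0.

Definition Bousfield_module p (M : lmodType (Zpl p)) (psi : rat -> M -> M) : Prop :=
  is_Rmodule psi /\
  forall x : M,
  [/\ (exists s : seq M, (forall y, y \in s -> inRx psi x y) /\
          forall y, inRx psi x y -> in_zspan s y),
  (* (b) psi j is diagonalisable on Rx (x) Q with eigenvalues integer powers
         of j: every element of Rx (x) Q is a sum of eigenvectors with
         eigenvalues j^k, k : int *)
      (forall j, zpunit p j -> forall y, inRx psi x y ->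
         exists c : nat, (0 < c)%N /\
         exists ys : seq (M * int),
           (forall u, u \in ys -> inRx psi x u.1 /\
               torsion (psi j u.1 - toZpl p (j ^ u.2) *: u.1)) /\
           torsion (c%:R *: y - \sum_(u <- ys) u.1)) &
  (* (c) the action on Rx / p^m Rx factors through (Z/p^k)^x for large k *)
      (forall m : nat, (1 <= m)%N -> exists k : nat,
         forall j1 j2, zpunit p j1 -> zpunit p j2 ->
           (j1 - j2) / (p%:Q ^+ k) \in zploc p ->
           forall y, inRx psi x y ->
             exists z, inRx psi x z /\ psi j1 y - psi j2 y = (p ^ m)%:R *: z)].

(* ---------- The ring A of degree-zero stable operations ---------- *)
(* Model: an operation is recorded by its eigenvalues on the coefficient
   groups pi_{2k} K_(p) = Z_(p), k : int; Psi^j acts there by j^k, so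
   Psi^q is k |-> q^k, ring operations are pointwise. *)

Definition qi (q : int) (i : nat) : rat :=
  (q%:Q) ^ ((-1) ^+ i * (i./2)%:Z).

Definition Theta (q : int) (n : nat) (X : rat) : rat :=
  \prod_(1 <= i < n.+1) (X - qi q i).

(* f is the operation sum_n a_n Phi_n, a_n in Z_(p), where
   Phi_n = Theta_n(Psi^q) acts on pi_{2k} by Theta_n(q^k) *)
Definition represents p (q : int) (a : nat -> rat) (f : int -> rat) : Prop :=
  (forall n, a n \in zploc p) /\
  forall k : int, exists N, forall N', (N <= N')%N ->
     f k = \sum_(n < N') a n * Theta q n (q%:Q ^ k).

Definition inA p (q : int) (f : int -> rat) : Prop :=
  exists a, represents p q a f.

Definition inAm p (q : int) (m : nat) (f : int -> rat) : Prop :=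
  exists a, (forall n, (n < m)%N -> a n = 0) /\ represents p q a f.

Definition Psi (j : rat) : int -> rat := fun k => j ^ k.

Definition is_Amodule p (q : int) (M : lmodType (Zpl p))
    (act : (int -> rat) -> M -> M) : Prop :=
  [/\ (forall f, inA p q f -> forall x y, act f (x + y) = act f x + act f y),
      (forall f g, inA p q f -> inA p q g -> forall x,
          act (fun k => f k + g k) x = act f x + act g x),
      (forall f g, inA p q f -> inA p q g -> forall x,
          act (fun k => f k * g k) x = act f (act g x)) &
      (forall x, act (fun _ => 1) x = x)].

Definition extends_R p (M : lmodType (Zpl p)) (psi : rat -> M -> M)
    (act : (int -> rat) -> M -> M) : Prop :=
  forall j, zpunit p j -> forall x, act (Psi j) x = psi j x.

Definition discrete_A p (q : int) (M : lmodType (Zpl p))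
    (act : (int -> rat) -> M -> M) : Prop :=
  forall x, exists n : nat, forall f, inAm p q n f -> act f x = 0.

Definition primitive_mod (q : int) (m : nat) : Prop :=
  coprime `|q| m /\
  forall e : nat, (0 < e)%N -> (q ^+ e == 1 %[mod m%:Z])%Z -> (totient m <= e)%N.

(* Main.v *)
Require Import Defs.
From HB Require Import structures.
From mathcomp Require Import all_boot all_order all_algebra.
From mathcomp Require Import ring zify.
From Stdlib Require Classical_Prop FunctionalExtensionality ClassicalEpsilon.
Set Implicit Arguments. Unset Strict Implicit. Unset Printing Implicit Defensive.
Import Order.TTheory GRing.Theory Num.Theory.
Local Open Scope ring_scope.

(** Let t_0, t_1, ... be the nodes q_1, q_2, ..., which exhaust the integer
    powers of q, so that Phi_n acts as Theta_n(psi^q) with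
    Theta_n = prod_(i < n) (X - t_i).  Everything reduces to the fact that
    each x in M is killed by Theta_n(psi^q) for some n.  By (b), Theta_n(psi^q) x
    is torsion for large n.  Modulo p, a product of 2 (p-1) p^k consecutive
    factors X - t_i is (X^((p-1) p^k) - 1)^2 since q generates F_p^*, and by (c)
    X^((p-1) p^k) - 1 maps y into p R y for k large; so finitely many further
    factors kill a torsion element.

    The action of f on x is then P(psi^q) x for any polynomial P over Z_(p)
    taking at the nodes t_i, i < n, the eigenvalues of f: two such P differ by a
    multiple of Theta_n.  This makes multiplicativity immediate.  That Psi^j acts
    as psi^j follows by approximating j p-adically by powers of q, which generate
    a dense subgroup of Z_(p)^*, and from the vanishing of the intersection of the
    p^m R x.  Uniqueness: discreteness truncates f to a finite sum of the Phi_n,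
    and these are polynomials in Psi^q. *)

(** * The ring Z_(p) and its residue field *)

Section LocalIntegers.
Variables (p : nat).
Hypothesis p_pr : prime p.
Local Notation O := (Zpl p).

Lemma zval_inj : injective (@zval p).
Proof. exact: val_inj. Qed.

Lemma zvalD (x y : O) : zval (x + y) = zval x + zval y.
Proof. exact: (raddfD (val : O -> rat)). Qed.

Lemma zval0 : zval (0 : O) = 0.
Proof. exact: (raddf0 (val : O -> rat)). Qed.

Lemma zvalB (x y : O) : zval (x - y) = zval x - zval y.
Proof. exact: (raddfB (val : O -> rat)). Qed.

Lemma zvalM (x y : O) : zval (x * y) = zval x * zval y.
Proof. exact: (rmorphM (val : O -> rat)). Qed.

Lemma zval1 : zval (1 : O) = 1.
Proof. exact: (rmorph1 (val : O -> rat)). Qed.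

Lemma zvalX (x : O) n : zval (x ^+ n) = zval x ^+ n.
Proof. exact: (rmorphXn (val : O -> rat)). Qed.

Lemma zval_nat n : zval (n%:R : O) = n%:R.
Proof. exact: (rmorph_nat (val : O -> rat)). Qed.

Lemma zval_int n : zval (n%:~R : O) = n%:~R.
Proof. exact: (rmorph_int (val : O -> rat)). Qed.

Lemma toZplK x : x \in zploc p -> zval (toZpl p x) = x.
Proof. by move=> xp; rewrite /toZpl -[zval _]/(val _) insubdK. Qed.

Lemma zvalK (x : O) : toZpl p (zval x) = x.
Proof. by apply: zval_inj; rewrite toZplK ?zvalP. Qed.

Definition residue (x : O) : 'F_p :=
  (numq (zval x))%:~R / (denq (zval x))%:~R.

Lemma Fp_int_eq0 (n : int) : ((n%:~R : 'F_p) == 0) = (p %| `|n|)%N.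
Proof.
have h (m : nat) : ((m%:R : 'F_p) == 0) = (p %| m)%N.
  by rewrite -(dvdn_pcharf (pchar_Fp p_pr)).
by case: n => m; rewrite ?NegzE ?rmorphN ?oppr_eq0 /= -?pmulrn h // abszN.
Qed.

Lemma Fp_int_neq0 (n : int) : coprime p `|n| -> (n%:~R : 'F_p) != 0.
Proof. by rewrite Fp_int_eq0 prime_coprime. Qed.

Lemma zval_denq (x : O) : zval x * (denq (zval x))%:~R = (numq (zval x))%:~R.
Proof.
rewrite -{1}[zval x]divq_num_den mulfVK //.
by rewrite intr_eq0 denq_neq0.
Qed.

(** Since any fraction with denominator prime to [p] computes the residue, the morphism laws can be
    checked on unreduced sums and products of fractions. *)
Lemma residue_frac (x : O) (n d : int) : coprime p `|d| ->
  zval x * d%:~R = n%:~R -> residue x = n%:~R / d%:~R.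
Proof.
move=> cd e; have d0 := Fp_int_neq0 cd.
have c2 := Fp_int_neq0 (zvalP x).
rewrite /residue; apply/eqP; rewrite eqr_div //; apply/eqP.
rewrite -!rmorphM /=; congr (_%:~R).
apply/eqP; rewrite -(eqr_int rat) !rmorphM /= -e -zval_denq.
by apply/eqP; ring.
Qed.

Lemma residue_is_zmod_morphism : zmod_morphism residue.
Proof.
move=> x y; have cx := zvalP x; have cy := zvalP y.
have nx := Fp_int_neq0 cx; have ny := Fp_int_neq0 cy.
rewrite (@residue_frac _ (numq (zval x) * denq (zval y) -
   numq (zval y) * denq (zval x)) (denq (zval x) * denq (zval y))).
- by rewrite /residue rmorphB !rmorphM /= -(mulNr _ (_)^-1) addf_div // mulNr.
- by rewrite abszM coprimeMr; apply/andP; split.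
- by rewrite zvalB rmorphB !rmorphM /= -!zval_denq; ring.
Qed.

Lemma residue_is_monoid_morphism : monoid_morphism residue.
Proof.
split; first by rewrite (@residue_frac _ 1 1) ?coprimen1 ?divr1 // zval1.
move=> x y; have cx := zvalP x; have cy := zvalP y.
have nx := Fp_int_neq0 cx; have ny := Fp_int_neq0 cy.
rewrite (@residue_frac _ (numq (zval x) * numq (zval y))
   (denq (zval x) * denq (zval y))).
- by rewrite /residue !rmorphM /= mulf_div.
- by rewrite abszM coprimeMr; apply/andP; split.
- by rewrite zvalM !rmorphM /= -!zval_denq; ring.
Qed.

Definition residue_rmorphism : {rmorphism O -> 'F_p} :=
  HB.pack residue
    (GRing.isZmodMorphism.Build _ _ residue residue_is_zmod_morphism)
    (GRing.isMonoidMorphism.Build _ _ residue residue_is_monoid_morphism).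

Lemma Zpl_mulf_eq0 (x y : O) : x * y = 0 -> x = 0 \/ y = 0.
Proof.
move/(congr1 (@zval p)); rewrite zvalM zval0 => /eqP; rewrite mulf_eq0.
by case/orP=> /eqP h; [left|right]; apply: zval_inj; rewrite h zval0.
Qed.

Lemma residue_eq0 (x : O) : residue x = 0 -> exists y, x = p%:R * y.
Proof.
move=> /eqP; rewrite /residue mulf_eq0 invr_eq0.
rewrite (negbTE (Fp_int_neq0 (zvalP x))) orbF Fp_int_eq0 => pn.
have [m em]: exists m, numq (zval x) = p%:Z * m.
  by case/dvdzP: (pn : (p%:Z %| numq (zval x))%Z) => m ->; exists m; rewrite mulrC.
have d0: denq (zval x) != 0 by rewrite denq_neq0.
exists (toZpl p (m%:~R / (denq (zval x))%:~R)).
apply: zval_inj; rewrite zvalM zval_nat toZplK; last exact: zploc_frac (zvalP x).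
by rewrite -{1}[zval x]divq_num_den em rmorphM /= mulrA pmulrn.
Qed.

Lemma Zpl_unit_frac (n d : int) : coprime p `|n| -> coprime p `|d| ->
  n != 0 -> d != 0 ->
  toZpl p (n%:~R / d%:~R) * toZpl p (d%:~R / n%:~R) = 1.
Proof.
move=> cn cd n0 d0; apply: zval_inj; rewrite zvalM !toZplK ?zval1 ?zploc_frac //.
have n1 : (n%:~R : rat) != 0 by rewrite intr_eq0.
have d1 : (d%:~R : rat) != 0 by rewrite intr_eq0.
by field; rewrite n1 d1.
Qed.

(** The [p]-adic valuation, except that its value at 0 is 0 instead of infinity. *)
Definition Zpl_val (x : O) : nat := logn p `|numq (zval x)|.

Lemma Zpl_valE (x : O) : x != 0 ->
  exists u u' : O, u * u' = 1 /\ x = p%:R ^+ Zpl_val x * u.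
Proof.
move=> x0.
have n0: numq (zval x) != 0.
  rewrite numq_eq0; apply: contra x0 => /eqP h; apply/eqP/zval_inj.
  by rewrite h zval0.
have d0: denq (zval x) != 0 by rewrite denq_neq0.
have np: (0 < `|numq (zval x)|)%N by rewrite absz_gt0.
have [m cm em] := pfactor_coprime p_pr np.
set n := (sgz (numq (zval x)) * m%:Z).
have am : `|n|%N = m.
  by rewrite /n abszM /sgz (negbTE n0); case: ifP => _; rewrite mul1n.
have m0 : n != 0.
  rewrite -absz_eq0 am; apply: contraTneq cm => ->.
  by rewrite /coprime gcdn0; apply/negP => /eqP h; move: p_pr; rewrite h.
exists (toZpl p (n%:~R / (denq (zval x))%:~R)), (toZpl p ((denq (zval x))%:~R / n%:~R)).
split; first by apply: Zpl_unit_frac; rewrite ?am //; exact: zvalP x.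
apply: zval_inj; rewrite zvalM zvalX zval_nat toZplK; last exact: zploc_frac (zvalP x).
rewrite -{1}[zval x]divq_num_den mulrA; congr (_ / _).
rewrite {1}[numq _]intEsg em PoszM /n !rmorphM /= -!pmulrn natrX.
by rewrite /Zpl_val; ring.
Qed.

End LocalIntegers.

(** * Powers of q in Z_(p) *)

Section Generator.
Variables (p : nat) (q : int).
Hypothesis p_pr : prime p.
Hypothesis p_odd : odd p.
Hypothesis q_prim : primitive_mod q (p ^ 2).
Local Notation O := (Zpl p).
Local Notation rho := (residue_rmorphism p_pr).
Local Notation qO := (q%:~R : O).

Lemma q_coprime : coprime p `|q|.
Proof. by case: q_prim => + _; rewrite coprime_sym coprime_pexpl. Qed.

Lemma q_order_mod_p2 e : (0 < e)%N -> ((p ^ 2)%:Z %| q ^+ e - 1)%Z ->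
  (p.-1 * p <= e)%N.
Proof.
move=> e0 d; case: q_prim => _ /(_ e e0).
by rewrite eqz_mod_dvd => /(_ d); rewrite totient_pfactor // expn1.
Qed.

Lemma residue_int n : rho n%:~R = n%:~R.
Proof. exact: rmorph_int. Qed.

Lemma residue_p : rho p%:R = 0.
Proof. by rewrite rmorph_nat; apply/eqP; rewrite -(dvdn_pcharf (pchar_Fp p_pr)). Qed.

Lemma residue_q_neq0 : rho qO != 0.
Proof. by rewrite residue_int; apply: (Fp_int_neq0 p_pr); exact: q_coprime. Qed.

Lemma Fp_unit_order (x : 'F_p) : x != 0 -> x ^+ p.-1 = 1.
Proof.
move=> x0; have xp : x ^+ p = x.
  rewrite -[x]natr_Zp -natrX -[LHS](Fp_nat_mod p_pr) fermat_little //.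
  exact: Fp_nat_mod.
by apply: (mulfI x0); rewrite -exprS prednK ?prime_gt0 // xp mulr1.
Qed.

(** If q^e is 1 modulo p, then p divides both factors of q^(ep) - 1 = (q^e - 1)(1 + q^e + ... +
    q^(e(p-1))), the second having p terms congruent to 1. Hence q^(ep) is 1 modulo p^2, and (p-1)p
    <= ep. *)
Lemma q_order_mod_p e : (0 < e)%N -> rho qO ^+ e = 1 -> (p.-1 <= e)%N.
Proof.
move=> e0 qe; rewrite -(leq_pmul2r (prime_gt0 p_pr)).
apply: q_order_mod_p2; first by rewrite muln_gt0 e0 prime_gt0.
rewrite exprM subrX1 PoszM; apply: dvdz_mul.
- rewrite dvdzE /= -(Fp_int_eq0 p_pr) rmorphB rmorphXn /=.
  by rewrite -residue_int qe subrr.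
- rewrite dvdzE /= -(Fp_int_eq0 p_pr) rmorph_sum /=.
  under eq_bigr => i _ do rewrite !rmorphXn /= -residue_int qe expr1n.
  by rewrite sumr_const card_ord -(dvdn_pcharf (pchar_Fp p_pr)).
Qed.

Lemma residue_q_prim : p.-1.-primitive_root (rho qO).
Proof.
have p1 : (0 < p.-1)%N by rewrite -ltnS prednK ?prime_gt0 ?prime_gt1.
have [m pm dm] := prim_order_exists p1 (Fp_unit_order residue_q_neq0).
suff -> : p.-1 = m by [].
apply/eqP; rewrite eqn_leq (dvdn_leq p1 dm) andbT.
by apply: q_order_mod_p; [exact: prim_order_gt0 pm | exact: prim_expr_order].
Qed.

Lemma exp1D (R : comNzRingType) (y : R) i :
  exists s, (1 + y) ^+ i = 1 + y *+ i + y ^+ 2 * s.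
Proof.
elim: i => [|i [s es]]; first by exists 0; rewrite expr0 mulr0n; ring.
exists (i%:R + s + y * s); rewrite exprS es mulrS -mulr_natr; ring.
Qed.

Lemma sum_exp1D (R : comNzRingType) (y : R) n :
  exists s, \sum_(i < n) (1 + y) ^+ i = n%:R + y * 'C(n, 2)%:R + y ^+ 2 * s.
Proof.
rewrite -bin2_sum big_mkord; elim: n => [|n [s es]].
  by exists 0; rewrite !big_ord0; ring.
have [s' es'] := exp1D y n; exists (s + s').
by rewrite !big_ord_recr /= es es' natrD -mulr_natr [n.+1%:R]mulrS; ring.
Qed.

(** With y = p^a u, (1+y)^p - 1 is y times a sum of p powers of 1+y, which is p + y C(p,2) modulo
    y^2. As p is odd, p divides C(p,2), and this sum is p times an element of residue 1. *)
Lemma pow_lift (a : nat) (u : O) : (0 < a)%N ->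
  exists2 u', (1 + p%:R ^+ a * u) ^+ p = 1 + p%:R ^+ a.+1 * u' & rho u' = rho u.
Proof.
move=> a0; have [y yE] : exists y, y = p%:R ^+ a * u by eexists.
have ey : y = p%:R * (p%:R ^+ a.-1 * u) by rewrite yE mulrA -exprS prednK.
have ry : rho y = 0 by rewrite ey rmorphM residue_p mul0r.
have p3 : (2 < p)%N by move: p_odd (prime_gt1 p_pr); case: (p) => [|[|[|]]].
have [c ec] : exists c, 'C(p, 2) = (p * c)%N.
  have /dvdnP[c ->] : (p %| 'C(p, 2))%N by apply: prime_dvd_bin.
  by exists c; rewrite mulnC.
have [S eS] := sum_exp1D y p.
exists (u * (1 + y * c%:R + (p%:R ^+ a.-1 * u) * y * S)); last first.
  by rewrite rmorphM !rmorphD !rmorphM ry rmorph1 mulr0 !mul0r !addr0 mulr1.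
apply: (addIr (-1)); rewrite -yE subrX1 eS ec natrM [p%:R ^+ a.+1]exprS.
have -> : y ^+ 2 = p%:R * (p%:R ^+ a.-1 * u) * y by rewrite -ey expr2.
have -> : 1 + y - 1 = y by ring.
rewrite {1}yE; ring.
Qed.

(** The base case holds because p^2 dividing q^(p-1) - 1 would contradict the order of q modulo p^2;
    [pow_lift] then raises the valuation by exactly one at a time. *)
Lemma q_pow_lift K : exists2 u : O,
  qO ^+ (p.-1 * p ^ K) = 1 + p%:R ^+ K.+1 * u & rho u != 0.
Proof.
elim: K => [|K [u eu u0]]; last first.
  have [u' eu' ru] := @pow_lift K.+1 u isT.
  by exists u'; rewrite ?ru // expnSr mulnA exprM eu eu'.
have p1 : (0 < p.-1)%N by rewrite -ltnS prednK ?prime_gt0 ?prime_gt1.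
have d : (p%:Z %| q ^+ p.-1 - 1)%Z.
  rewrite dvdzE /= -(Fp_int_eq0 p_pr) rmorphB rmorphXn /= -residue_int.
  by rewrite (Fp_unit_order residue_q_neq0) subrr.
case/dvdzP: d => u eu; exists u%:~R.
  rewrite muln1 expr1 -rmorphXn /= -(subrK 1 (q ^+ _)) eu.
  by rewrite rmorphD rmorphM /= addrC mulrC.
rewrite residue_int; apply/negP; rewrite (Fp_int_eq0 p_pr) => pu.
have : (p.-1 * p <= p.-1)%N.
  apply: q_order_mod_p2 => //; rewrite eu PoszM /=.
  by apply: dvdz_mul => //; rewrite dvdzE.
by rewrite leqNgt -{1}(muln1 p.-1) ltn_pmul2l // prime_gt1.
Qed.

(** Successive approximation: a primitive root modulo p settles [K = 0], then a factor q^((p-1) p^K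
    t) corrects the next p-adic digit. *)
Lemma q_dense K (j : O) : rho j != 0 ->
  exists e w, j = qO ^+ e + p%:R ^+ K.+1 * w.
Proof.
move=> j0; elim: K => [|K [e [w ew]]].
  have [i ei] := prim_rootP residue_q_prim (Fp_unit_order j0).
  have [y ey] : exists y, j - qO ^+ i = p%:R * y.
    by apply: (residue_eq0 p_pr); rewrite [LHS](rmorphB rho) rmorphXn ei subrr.
  by exists i, y; rewrite expr1 -ey addrC subrK.
have [u eu u0] := q_pow_lift K.
(* [t] solves t u q^e = w modulo p, which cancels the leading term of the error. *)
pose t := (rho w / (rho u * rho (qO ^+ e)) : 'F_p).
have qe0 : rho (qO ^+ e) != 0 by rewrite rmorphXn expf_neq0 ?residue_q_neq0.
have [y ey] : exists y, w - (nat_of_ord t)%:R * u * qO ^+ e = p%:R * y.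
  apply: (residue_eq0 p_pr); rewrite [LHS](rmorphB rho) !rmorphM rmorph_nat.
  have -> : (nat_of_ord t)%:R = t by exact: natr_Zp.
  by rewrite -mulrA /t divfK ?subrr // mulf_neq0.
have [s es] := exp1D (p%:R ^+ K.+1 * u) t.
exists (e + p.-1 * p ^ K * t)%N, (y - p%:R ^+ K * u ^+ 2 * s * qO ^+ e).
rewrite exprD exprM eu es {1}ew -mulr_natr.
rewrite -(subrK ((nat_of_ord t)%:R * u * qO ^+ e) w) ey !exprS; ring.
Qed.

End Generator.

(** * Nodes and interpolation *)

Section Units.
Variable p : nat.
Hypothesis p_pr : prime p.
Local Notation O := (Zpl p).
Local Notation rho := (residue_rmorphism p_pr).

Lemma zpunit_exp j (k : int) : zpunit p j -> zpunit p (j ^ k).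
Proof.
case/and3P=> j0 jp jVp; rewrite /zpunit expfz_neq0 //=.
by case: k => n; rewrite ?NegzE -?invr_expz ?invrK -exprnP -?exprVn !rpredX.
Qed.

Lemma zval_zpow j (k : int) : zpunit p j -> zval (toZpl p (j ^ k)) = j ^ k.
Proof. by move=> /(zpunit_exp k)/and3P[_ jk _]; rewrite toZplK. Qed.

Lemma residue_zpunit j : zpunit p j -> rho (toZpl p j) != 0.
Proof.
case/and3P=> j0 jp jVp.
have e : toZpl p j * toZpl p j^-1 = 1.
  by apply: zval_inj; rewrite zvalM !toZplK // zval1 mulfV.
apply/negP => /eqP h; have := congr1 rho e.
by rewrite rmorphM h mul0r rmorph1 => /eqP; rewrite eq_sym oner_eq0.
Qed.

(** Negative exponents reduce to positive ones through 1/i - 1/j = -(i - j)/(ij), where i and j are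
    units. *)
Lemma zpow_congr (i j c : rat) (k : int) : zpunit p i -> zpunit p j ->
  (i - j) / c \in zploc p -> (i ^ k - j ^ k) / c \in zploc p.
Proof.
have congrX (x y : rat) n : x \in zploc p -> y \in zploc p ->
    (x - y) / c \in zploc p -> (x ^+ n - y ^+ n) / c \in zploc p.
  move=> xp yp xy; rewrite subrXX mulrAC rpredM //.
  by apply: rpred_sum => l _; rewrite rpredM ?rpredX.
case/and3P=> i0 ip iVp /and3P[j0 jp jVp] ij.
case: k => n; first exact: congrX.
rewrite NegzE -!exprz_inv; apply: congrX => //.
have -> : (i^-1 - j^-1) / c = - ((i - j) / c * i^-1 * j^-1).
  by have [->|c0] := eqVneq c 0; [rewrite invr0; ring | field; rewrite c0 i0 j0].
by rewrite rpredN (rpredM (rpredM ij iVp) jVp).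
Qed.

End Units.

(** The exponent of q in q_(i+1): nodes are counted from 0, and the exponents run through 0, 1, -1,
    2, -2, and so on. *)
Definition node_exp (i : nat) : int := (-1) ^+ i.+1 * (i.+1./2)%:Z.

Lemma node_expE i :
  node_exp i = if odd i then (i.+1./2)%:Z else - (i.+1./2)%:Z.
Proof.
rewrite /node_exp -signr_odd /=; case: (odd i) => /=; first by rewrite mul1r.
by rewrite expr1 mulN1r.
Qed.

Lemma node_exp_inj : injective node_exp.
Proof.
move=> i j; rewrite !node_expE -!uphalfE !uphalf_half.
move: (odd_double_half i) (odd_double_half j); rewrite -!muln2.
by case: (odd i); case: (odd j); lia.
Qed.

Lemma node_exp_surj k : exists i, node_exp i = k.
Proof.
case: k => [[|n]|n].
- by exists 0.
- by exists n.*2.+1; rewrite node_expE /= odd_double /= doubleK.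
- by exists n.+1.*2; rewrite node_expE odd_double NegzE -uphalfE uphalf_double.
Qed.

Section Nodes.
Variables (p : nat) (q : int).
Hypothesis p_pr : prime p.
Hypothesis p_odd : odd p.
Hypothesis q_prim : primitive_mod q (p ^ 2).
Local Notation O := (Zpl p).
Local Notation rho := (residue_rmorphism p_pr).
Local Notation qO := (q%:~R : O).

Definition node (i : nat) : O := toZpl p (q%:Q ^ node_exp i).

Lemma zpunit_q : zpunit p q%:Q.
Proof.
have cq := q_coprime q_prim.
have q0 : q != 0.
  apply: contraTneq cq => ->; rewrite /coprime gcdn0.
  by apply/negP => /eqP h; move: p_pr; rewrite h.
rewrite /zpunit intr_eq0 q0 /= -[q%:Q]divr1 -[1]/(1%:~R) zploc_frac ?coprimen1 //=.
by rewrite divr1 -[q%:~R^-1]mul1r -[1]/(1%:~R) zploc_frac.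
Qed.

Lemma zval_node i : zval (node i) = q%:Q ^ node_exp i.
Proof. by rewrite zval_zpow ?zpunit_q. Qed.

Lemma q_exp_inj : injective (fun k : int => q%:Q ^ k).
Proof.
have p3 : (2 < p)%N by move: p_odd (prime_gt1 p_pr); case: (p) => [|[|[|]]].
have q0 : q%:Q != 0 by case/and3P: zpunit_q.
have q1 : q ^+ 2 != 1.
  apply/eqP => h; have : (p.-1 * p <= 2)%N.
    by apply: (q_order_mod_p2 p_pr q_prim) => //; rewrite h subrr dvdz0.
  by rewrite leqNgt (leq_trans p3) // leq_pmull //; move: p3; lia.
(* As q may be negative, squaring is used to get a positive base, whose powers are distinct once it
   differs from 1. *)
move=> k l /= /(congr1 (fun x : rat => x ^ (2 : int))); rewrite !exprz_exp.
rewrite ![_ * 2]mulrC -!exprz_exp; apply: ieexprIz.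
  by rewrite -exprnP lt0r sqr_ge0 expf_neq0.
by rewrite -exprnP -rmorphXn /= -[1]/(1%:~R) eqr_int.
Qed.

Lemma node_neq i j : i != j -> node i - node j != 0.
Proof.
move=> ij; rewrite subr_eq0; apply: contra ij => /eqP/(congr1 (@zval p)).
by rewrite !zval_node => /q_exp_inj/node_exp_inj ->.
Qed.

(** [theta 0 n] is Theta_n; the lower bound allows blocks of consecutive factors to be split off. *)
Definition theta (a b : nat) : {poly O} := \prod_(a <= i < b) ('X - (node i)%:P).

Lemma theta_cat a b c : (a <= b)%N -> (b <= c)%N ->
  theta a c = theta a b * theta b c.
Proof. exact: big_cat_nat. Qed.

Lemma theta_recr a b : (a <= b)%N -> theta a b.+1 = theta a b * ('X - (node b)%:P).
Proof. exact: big_nat_recr. Qed.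

Lemma horner_theta a b x : (theta a b).[x] = \prod_(a <= i < b) (x - node i).
Proof. by rewrite horner_prod; apply: eq_bigr => i _; rewrite hornerXsubC. Qed.

Lemma zval_theta n x : zval (theta 0 n).[x] = Theta q n (zval x).
Proof.
rewrite horner_theta /Theta big_add1 /=.
elim: n => [|n IH]; first by rewrite !big_nil zval1.
by rewrite !big_nat_recr //= IH zval_node.
Qed.

Lemma theta_node_eq0 n i : (i < n)%N -> (theta 0 n).[node i] = 0.
Proof.
move=> lt_in; rewrite horner_theta (bigD1_seq i) ?mem_index_iota ?iota_uniq //=.
by rewrite subrr mul0r.
Qed.

Lemma Theta_node_eq0 n i : (i < n)%N -> Theta q n (q%:Q ^ node_exp i) = 0.
Proof. by move=> lt_in; rewrite -zval_node -zval_theta theta_node_eq0 ?zval0. Qed.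

Lemma theta_node_neq0 n : (theta 0 n).[node n] != 0.
Proof.
rewrite horner_theta; suff: forall m, (m <= n)%N ->
  \prod_(0 <= i < m) (node n - node i) != 0 by exact.
elim=> [|m IH] mn; first by rewrite big_nil oner_neq0.
rewrite big_nat_recr //=; apply/negP => /eqP/Zpl_mulf_eq0[]/eqP.
  exact/negP/IH/ltnW.
by apply/negP/node_neq; rewrite neq_ltn mn orbT.
Qed.

(** Roots are split off one at a time: the nodes being distinct, the factors already found do not
    vanish at the next node, so the cofactor does. *)
Lemma theta_dvd n (P : {poly O}) : (forall i, (i < n)%N -> P.[node i] = 0) ->
  exists Q, P = Q * theta 0 n.
Proof.
elim: n => [|n IH] Pn; first by exists P; rewrite /theta big_nil mulr1.
have [|Q eQ] := IH; first by move=> i /ltnW; exact: Pn.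
have := Pn n (ltnSn n); rewrite eQ hornerM => /Zpl_mulf_eq0[]/eqP h; last first.
  by move: h; rewrite (negbTE (theta_node_neq0 n)).
have [S eS] := factor_theorem _ _ h.
by exists S; rewrite theta_recr // eS; ring.
Qed.

(** Newton interpolation with denominators cleared: [(theta 0 n).[node n]] need not be a unit, which
    costs a power of p. It matters that [C] is chosen before [f]: in [psi_approx] the values [f]
    depend on an accuracy chosen after [C]. *)
Lemma interpolation n : exists C, forall f : nat -> O,
  exists P : {poly O}, forall i, (i < n)%N -> P.[node i] = p%:R ^+ C * f i.
Proof.
elim: n => [|n [C IH]]; first by exists 0 => f; exists 0.
have [u [u' [uu' et]]] := Zpl_valE p_pr (theta_node_neq0 n).
move: (Zpl_val _) et => v et.
exists (v + C)%N => f; have [P eP] := IH f.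
(* The last term vanishes at the earlier nodes; at [node n], where [theta 0 n] is p^v u, it supplies
   the missing amount. *)
exists ((p%:R ^+ v)%:P * P
  + (u' * (p%:R ^+ C * f n - P.[node n]))%:P * theta 0 n) => i.
rewrite ltnS leq_eqVlt hornerD !hornerM !hornerC => /orP[/eqP->|lt_in].
  rewrite et exprD -mulrA; move: (p%:R ^+ v) (p%:R ^+ C) => a c.
  move: (P.[_]) (f n) => b d.
  transitivity (a * b + u * u' * (a * (c * d - b))); first by ring.
  by rewrite uu'; ring.
by rewrite (eP i) // theta_node_eq0 // mulr0 addr0 exprD mulrA.
Qed.

End Nodes.

(** * Polynomials in an endomorphism *)

Section PolyAction.
Variables (R : comNzRingType) (M : lmodType R) (phi : {linear M -> M}).
Implicit Types (P Q : {poly R}) (x y : M).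

Definition poly_act P x : M := \sum_(i < size P) P`_i *: iter i phi x.

Lemma poly_actE n P x : (size P <= n)%N ->
  poly_act P x = \sum_(i < n) P`_i *: iter i phi x.
Proof.
move=> sP; rewrite /poly_act (big_ord_widen n (fun i => P`_i *: iter i phi x)) //.
rewrite big_mkcond; apply: eq_bigr => i _; case: ltnP => // h.
by rewrite nth_default // scale0r.
Qed.

Lemma poly_actDl P Q x : poly_act (P + Q) x = poly_act P x + poly_act Q x.
Proof.
pose n := maxn (size P) (size Q).
rewrite (@poly_actE n (P + Q)) ?size_polyD // (@poly_actE n P) ?leq_maxl //.
rewrite (@poly_actE n Q) ?leq_maxr // -big_split; apply: eq_bigr => i _ /=.
by rewrite coefD scalerDl.
Qed.

Lemma poly_actC c x : poly_act c%:P x = c *: x.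
Proof. by rewrite (@poly_actE 1) ?size_polyC_leq1 // big_ord1 coefC. Qed.

Lemma poly_act0l x : poly_act 0 x = 0.
Proof. by rewrite /poly_act size_poly0 big_ord0. Qed.

Lemma poly_act1l x : poly_act 1 x = x.
Proof. by rewrite poly_actC scale1r. Qed.

Lemma poly_actP P c x y :
  poly_act P (c *: x + y) = c *: poly_act P x + poly_act P y.
Proof.
rewrite /poly_act scaler_sumr -big_split; apply: eq_bigr => i _ /=.
have -> : iter i phi (c *: x + y) = c *: iter i phi x + iter i phi y.
  by elim: (nat_of_ord i) => //= n ->; rewrite linearP.
by rewrite scalerDr !scalerA mulrC.
Qed.

Lemma poly_actDr P x y : poly_act P (x + y) = poly_act P x + poly_act P y.
Proof. by have := poly_actP P 1 x y; rewrite !scale1r. Qed.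

Lemma poly_act0r P : poly_act P 0 = 0.
Proof. by apply: (addIr (poly_act P 0)); rewrite -poly_actDr !add0r. Qed.

Lemma poly_actZr P c x : poly_act P (c *: x) = c *: poly_act P x.
Proof. by have := poly_actP P c x 0; rewrite poly_act0r !addr0. Qed.

Lemma poly_actXM Q x : poly_act ('X * Q) x = phi (poly_act Q x).
Proof.
rewrite (@poly_actE (size Q).+1); last first.
  have [->|Q0] := eqVneq Q 0; first by rewrite mulr0 size_poly0.
  by rewrite mulrC size_mulX.
rewrite big_ord_recl coefXM scale0r add0r linear_sum; apply: eq_bigr => i _.
by rewrite coefXM /= linearZ.
Qed.

Lemma poly_act_phi P x : poly_act P (phi x) = phi (poly_act P x).
Proof.
by rewrite linear_sum; apply: eq_bigr => i _; rewrite linearZ -iterSr.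
Qed.

Lemma poly_actXn n x : poly_act 'X^n x = iter n phi x.
Proof.
elim: n => [|n IH]; first by rewrite expr0 poly_act1l.
by rewrite exprS poly_actXM IH.
Qed.

Lemma poly_actM P Q x : poly_act (P * Q) x = poly_act P (poly_act Q x).
Proof.
elim/poly_ind: P Q x => [|P c IH] Q x; first by rewrite mul0r !poly_act0l.
have aC y : poly_act (c%:P * Q) y = c *: poly_act Q y.
  rewrite mul_polyC (@poly_actE (size Q)) ?size_scale_leq // scaler_sumr.
  by apply: eq_bigr => i _; rewrite coefZ scalerA.
rewrite mulrDl -mulrA !poly_actDl IH poly_actXM aC poly_actC mulrC poly_actXM.
by rewrite poly_act_phi.
Qed.

End PolyAction.

(** * Blocks of consecutive factors X - t_i modulo p *)

Lemma prod_periodic (R : comPzSemiRingType) (F : nat -> R) n c N :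
  (forall i, F (i + n)%N = F i) ->
  \prod_(N <= i < N + n * c) F i = (\prod_(0 <= i < n) F i) ^+ c.
Proof.
move=> Fn.
(* Moving the window by one trades [F a] for the equal factor [F (a + n)]. *)
have shift a : \prod_(a <= i < a + n) F i = \prod_(0 <= i < n) F i.
  elim: a => [|a <-]; first by rewrite add0n.
  case: n Fn => [|n] Fn; first by rewrite !addn0 !big_geq.
  rewrite !addnS big_nat_recr ?leq_addr //= [RHS]big_ltn ?ltnS ?leq_addr //.
  by rewrite mulrC addSn -addnS Fn.
elim: c N => [|c IH] N; first by rewrite muln0 addn0 big_geq.
rewrite (big_cat_nat (n := N + n)) ?leq_addr //=; last first.
  by rewrite leq_add2l mulnS leq_addr.
by rewrite shift mulnS addnA IH exprS.
Qed.

Section Reduction.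
Variables (p : nat) (q : int).
Hypothesis p_pr : prime p.
Hypothesis p_odd : odd p.
Hypothesis q_prim : primitive_mod q (p ^ 2).
Local Notation O := (Zpl p).
Local Notation rho := (residue_rmorphism p_pr).
Local Notation qO := (q%:~R : O).
Local Notation node := (@node p q).
Local Notation theta := (@theta p q).

Lemma poly_residue_eq (P Q : {poly O}) : map_poly rho P = map_poly rho Q ->
  exists S, P = Q + p%:R *: S.
Proof.
(* The quotient by p is formed in the rationals; [toZpl] loses nothing because the coefficients of
   [P - Q] have residue 0. *)
move=> ePQ; exists (\poly_(i < size (P - Q)) toZpl p (zval (P - Q)`_i / p%:R)).
suff e : p%:R *: \poly_(i < size (P - Q)) toZpl p (zval (P - Q)`_i / p%:R) = P - Q.
  by rewrite e addrC subrK.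
apply/polyP => i; rewrite coefZ coef_poly.
case: ltnP => [_|h]; last by rewrite mulr0 nth_default.
have [y ->] : exists y, (P - Q)`_i = p%:R * y.
  apply: (residue_eq0 p_pr); have := congr1 (fun S : {poly 'F_p} => S`_i) ePQ.
  by rewrite !coef_map => h; rewrite coefB [LHS](rmorphB rho) h subrr.
congr (_ * _); rewrite zvalM zval_nat mulrC mulKf ?zvalK //.
by rewrite pnatr_eq0 -lt0n prime_gt0.
Qed.

Lemma residue_node i : rho (node i) =
  if odd i then rho qO ^+ (i.+1./2) else (rho qO ^+ (i.+1./2))^-1.
Proof.
have zn := zval_node p_pr q_prim i; have zu := zpunit_q p_pr q_prim.
rewrite -rmorphXn; move: zn; rewrite node_expE; case: (odd i) => zn.
  by congr (rho _); apply: zval_inj; rewrite zn zvalX zval_int -exprnP.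
have e : node i * qO ^+ i.+1./2 = 1.
  apply: zval_inj; rewrite zvalM zvalX zval_int zn zval1 -invr_expz -exprnP.
  by rewrite mulVf // expf_neq0 //; case/and3P: zu.
have := congr1 rho e; rewrite rmorphM rmorph1 => e'.
have h : rho (qO ^+ i.+1./2) != 0.
  by apply/eqP => h; move/eqP: e'; rewrite h mulr0 eq_sym oner_eq0.
by apply: (mulIf h); rewrite e' mulVf.
Qed.

Lemma prim_root_prod (F : fieldType) n (z : F) : (0 < n)%N -> n.-primitive_root z ->
  \prod_(0 <= j < n) ('X - (z ^+ j.+1)%:P) = 'X^n - 1.
Proof.
move=> n0 zn; rewrite -(factor_Xn_sub_1 zn).
case: n n0 zn => // n _ zn; rewrite big_nat_recr //= [RHS]big_ltn // big_add1 /= mulrC.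
by rewrite (prim_expr_order zn) expr0.
Qed.

(** Indices 2j and 2j+1 contribute z^(-j) and z^(j+1); as j runs over a period, each of these two
    families meets every n-th root of unity once. *)
Lemma prod_alternating (F : fieldType) n (z : F) (f : nat -> F) :
  (0 < n)%N -> n.-primitive_root z ->
  (forall i, f i = if odd i then z ^+ (i.+1./2) else (z ^+ (i.+1./2))^-1) ->
  \prod_(0 <= i < n.*2) ('X - (f i)%:P) = ('X^n - 1) ^+ 2.
Proof.
move=> n0 zn fE.
have z0 : z != 0.
  apply/eqP => h; have /eqP := prim_expr_order zn.
  by rewrite h expr0n -leqn0 leqNgt n0 eq_sym oner_eq0.
have -> : \prod_(0 <= i < n.*2) ('X - (f i)%:P) =
   \prod_(0 <= j < n) (('X - ((z ^+ j)^-1)%:P) * ('X - (z ^+ j.+1)%:P)).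
  elim: (n) => [|m IH]; first by rewrite !big_geq.
  rewrite doubleS 3?big_nat_recr //= IH -mulrA !fE /= odd_double /=.
  by rewrite uphalf_double doubleK.
rewrite big_split /= prim_root_prod // expr2; congr (_ * _).
(* After reversal, the inverse of z^(n-j-1) is z^(j+1). *)
rewrite -(prim_root_prod n0 zn) big_nat_rev; apply: eq_big_nat => j /andP[_ jn] /=.
congr (_ - _%:P); rewrite add0n; apply: (mulfI (expf_neq0 (n - j.+1) z0)).
by rewrite mulfV ?expf_neq0 // -exprD subnK // (prim_expr_order zn).
Qed.

(** Modulo p the nodes are periodic in the index with period 2(p-1), so the start [N] is immaterial.
    One period gives (X^(p-1) - 1)^2, and Frobenius computes its p^k-th power. *)
Lemma residue_theta N k :
  map_poly rho (theta N (N + (p.-1).*2 * p ^ k)) =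
  ('X^(p.-1 * p ^ k) - 1) ^+ 2.
Proof.
have n0 : (0 < p.-1)%N by rewrite -ltnS prednK ?prime_gt0 ?prime_gt1.
have zn := residue_q_prim p_pr q_prim.
have -> a b : map_poly rho (theta a b) = \prod_(a <= i < b) ('X - (rho (node i))%:P).
  by rewrite rmorph_prod; apply: eq_bigr => i _; exact: map_polyXsubC.
move: (p.-1) n0 zn => n n0 zn; move: (rho qO) zn residue_node => z zn rn.
rewrite (@prod_periodic _ (fun i => 'X - (rho (node i))%:P)); last first.
  move=> i; rewrite !rn oddD odd_double addbF -addSn halfD odd_double andbF doubleK.
  by rewrite add0n exprD (prim_expr_order zn) mulr1.
rewrite (prod_alternating n0 zn rn).
rewrite exprAC; congr (_ ^+ 2).
have pc : [pchar {poly 'F_p}].-nat (p ^ k)%N.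
  rewrite pnatX; apply/orP; left; rewrite pnatE // pchar_poly.
  exact: pchar_Fp.
rewrite exprDn_pchar // -exprM; congr (_ + _).
(* Since p is odd, (-1)^(p^k) = -1. *)
by rewrite -signr_odd oddX p_odd orbT expr1.
Qed.

End Reduction.

(** * The Krull intersection theorem over Z_(p) *)

Section Krull.
Variable p : nat.
Hypothesis p_pr : prime p.
Local Notation O := (Zpl p).

(** Otherwise, taking m one above the valuation of [c] would make its unit part divisible by p. *)
Lemma Zpl_inf_div (c : O) : (forall m, exists b, c = p%:R ^+ m * b) -> c = 0.
Proof.
move=> dc; apply/eqP; apply/negPn/negP => c0.
have [u [u' [uu' ec]]] := Zpl_valE p_pr c0.
have [b eb] := dc (Zpl_val c).+1.
have p0 : (p%:R : O) ^+ Zpl_val c != 0.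
  apply: contra c0 => /eqP h; by rewrite ec h mul0r.
have ub : u - p%:R * b = 0.
  have : p%:R ^+ Zpl_val c * (u - p%:R * b) = 0.
    by rewrite mulrBr -ec {1}eb exprSr; ring.
  by case/Zpl_mulf_eq0 => // h; rewrite h eqxx in p0.
have := congr1 (residue_rmorphism p_pr) uu'.
rewrite rmorph1 -[u](subrK (p%:R * b)) ub add0r !rmorphM residue_p !mul0r.
by move/eqP; rewrite eq_sym oner_eq0.
Qed.

(** The comparison of valuations is restricted to nonzero [b] because [Zpl_val 0] is 0. *)
Lemma Zpl_dvd (a b : O) : a != 0 -> (b != 0 -> (Zpl_val a <= Zpl_val b)%N) ->
  exists c, b = a * c.
Proof.
move=> a0 ab; have [->|b0] := eqVneq b 0; first by exists 0; rewrite mulr0.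
have [u [u' [uu' ea]]] := Zpl_valE p_pr a0.
have [w [w' [_ eb]]] := Zpl_valE p_pr b0.
exists (p%:R ^+ (Zpl_val b - Zpl_val a) * u' * w).
rewrite {1}eb {1}ea -{1}(subnK (ab b0)) exprD.
move: (p%:R ^+ _) (p%:R ^+ _) => x y.
by transitivity (x * y * w * (u * u')); [rewrite uu'; ring | ring].
Qed.

(** Induction on the number of generators: a nontrivial relation allows one of them to be dropped,
    while for free generators the coordinates of [d] are divisible by every power of p. *)
Lemma Krull_intersection (M : lmodType O) r (s : 'I_r -> M) (d : M) :
  (forall m, exists c : 'I_r -> O, d = p%:R ^+ m *: \sum_i c i *: s i) -> d = 0.
Proof.
(* Only large [m] are kept in the hypothesis, since dropping a generator discards the [m] below the
   valuation of a coefficient. *)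
suff H : forall n, (forall m, (n <= m)%N -> exists c : 'I_r -> O,
    d = p%:R ^+ m *: \sum_i c i *: s i) -> d = 0 by move=> h; exact: (H 0).
elim: r s => [|r IH] s n hd.
  by have [c ->] := hd n (leqnn n); rewrite big_ord0 scaler0.
have [c0 ec0] := hd n (leqnn n).
(* Given a nontrivial relation, dividing it by its coefficient of least
   valuation yields a new generator killed by a power of p, which therefore
   does not contribute to p^m times the span for m large. *)
have [[c [[i ci] ec]]|free] : (exists c : 'I_r.+1 -> O,
    (exists i, c i != 0) /\ \sum_i c i *: s i = 0) \/
   forall c : 'I_r.+1 -> O, \sum_i c i *: s i = 0 -> forall i, c i = 0.
- apply: Classical_Prop.NNPP => /Classical_Prop.not_or_and[nrel nfree].
  case: nfree => c ec i; apply/eqP/negPn/negP => ci.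
  by case: nrel; exists c; split=> //; exists i.
- case: (@arg_minnP _ i (fun i => c i != 0) (fun i => Zpl_val (c i)) ci) => i0 c0' cmin.
  have [u eu] : exists u : 'I_r -> O, forall j, c (lift i0 j) = c i0 * u j.
    have /fin_all_exists[u eu] : forall j : 'I_r, exists w, c (lift i0 j) = c i0 * w.
      by move=> j; apply: Zpl_dvd => //; exact: cmin.
    by exists u.
  pose s' := s i0 + \sum_j u j *: s (lift i0 j).
  have cs' : c i0 *: s' = 0.
    rewrite -ec (bigD1_ord i0) //= scalerDr; congr (_ + _).
    by rewrite scaler_sumr; apply: eq_bigr => j _; rewrite scalerA eu.
  have [a [a' [aa' ea]]] := Zpl_valE p_pr c0'.
  have ps' : p%:R ^+ Zpl_val (c i0) *: s' = 0.
    have -> : p%:R ^+ Zpl_val (c i0) = a' * c i0.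
      by rewrite {2}ea mulrCA [a' * a]mulrC aa' mulr1.
    by rewrite -scalerA cs' scaler0.
  apply: (IH (fun j => s (lift i0 j)) (maxn n (Zpl_val (c i0)))) => m.
  rewrite geq_max => /andP[nm vm]; have [b ->] := hd m nm.
  exists (fun j => b (lift i0 j) - b i0 * u j).
  rewrite (bigD1_ord i0) //=.
  have -> : s i0 = s' - \sum_j u j *: s (lift i0 j) by rewrite addrK.
  rewrite scalerBr -addrA scalerDr scalerA -{1}(subnK vm) exprD.
  rewrite [_ * b i0]mulrAC -scalerA ps' scaler0 add0r; congr (_ *: _).
  rewrite addrC scaler_sumr -sumrB; apply: eq_bigr => j _.
  by rewrite scalerBl scalerA.
(* By freeness, the expansions of [d] at levels [n] and [n + m] have the same coordinates;
   cancelling p^n makes [c0 i] divisible by p^m. *)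
- rewrite ec0 big1 ?scaler0 // => i _.
  suff -> : c0 i = 0 by rewrite scale0r.
  apply: Zpl_inf_div => m; have [b eb] := hd (n + m)%N (leq_addr _ _).
  exists (b i); have := free (fun i => p%:R ^+ n * c0 i - p%:R ^+ (n + m) * b i).
  case/(_ _)/(_ i)/Wrap.
  - under eq_bigr => j _ do rewrite scalerBl -!scalerA.
    by rewrite sumrB -!scaler_sumr -ec0 -eb subrr.
  - have -> : p%:R ^+ n * c0 i - p%:R ^+ (n + m) * b i =
       p%:R ^+ n * (c0 i - p%:R ^+ m * b i) by rewrite exprD; ring.
  move/Zpl_mulf_eq0 => [h|/eqP]; last by rewrite subr_eq0 => /eqP.
  move/(congr1 (@zval p))/eqP: h.
  by rewrite zvalX zval_nat zval0 expf_eq0 pnatr_eq0 (gtn_eqF (prime_gt0 p_pr)) andbF.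
Qed.

End Krull.

(** * Bousfield modules *)

Section Bousfield.
Variables (p : nat) (q : int) (M : lmodType (Zpl p)) (psi : rat -> M -> M).
Hypothesis p_pr : prime p.
Hypothesis p_odd : odd p.
Hypothesis q_prim : primitive_mod q (p ^ 2).
Hypothesis psiB : Bousfield_module psi.
Local Notation O := (Zpl p).
Local Notation rho := (residue_rmorphism p_pr).
Local Notation qO := (q%:~R : O).
Local Notation node := (@node p q).
Local Notation theta := (@theta p q).

Let qU := zpunit_q p_pr q_prim.

Lemma psiP j : zpunit p j -> linear (psi j).
Proof. by case: psiB => -[psiL _ _] _ ju a x y; exact: psiL. Qed.

Lemma psi1 x : psi 1 x = x.
Proof. by case: psiB => -[]. Qed.

Lemma psiM j1 j2 x : zpunit p j1 -> zpunit p j2 ->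
  psi (j1 * j2) x = psi j1 (psi j2 x).
Proof. by case: psiB => -[_ _ H] _ u1 u2; exact: H. Qed.

(** Linearity of [psi j] is known for units only, hence the proof argument. *)
Definition psi_linear j (ju : zpunit p j) : {linear M -> M} :=
  HB.pack (psi j) (GRing.isLinear.Build O M M *:%R (psi j) (psiP ju)).

Definition psi_q : {linear M -> M} := psi_linear qU.
Local Notation pact := (poly_act psi_q).

Lemma zpunitX j n : zpunit p j -> zpunit p (j ^+ n).
Proof. exact: (@zpunit_exp p j n). Qed.

Lemma zpunit1 : zpunit p 1.
Proof. exact: (@zpunitX _ 0 qU). Qed.

Lemma iter_psi_q n x : iter n psi_q x = psi (q%:Q ^+ n) x.
Proof.
elim: n => [|n IH]; first by rewrite expr0 psi1.
by rewrite iterS IH exprS psiM ?zpunitX.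
Qed.

Lemma inRxD x y z : inRx psi x y -> inRx psi x z -> inRx psi x (y + z).
Proof.
move=> [s [su ->]] [t [tu ->]]; exists (s ++ t).
by rewrite all_cat su tu big_cat.
Qed.

Lemma inRx0 x : inRx psi x 0.
Proof. by exists [::]; rewrite big_nil. Qed.

Lemma inRxZ x y a : inRx psi x y -> inRx psi x (a *: y).
Proof.
move=> [s [su ->]]; exists [seq (u.1, a * u.2) | u <- s]; rewrite all_map; split=> //.
by rewrite big_map scaler_sumr; apply: eq_bigr => u _; rewrite scalerA.
Qed.

Lemma inRx_psi x j : zpunit p j -> inRx psi x (psi j x).
Proof. by move=> ju; exists [:: (j, 1)]; rewrite /= ju big_seq1 scale1r. Qed.

Lemma inRx_self x : inRx psi x x.
Proof. by have := inRx_psi x zpunit1; rewrite psi1. Qed.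

Lemma inRx_pact x P : inRx psi x (pact P x).
Proof.
rewrite /poly_act; elim/big_ind: _ => [|y z|i _]; [exact: inRx0|exact: inRxD|].
by apply: inRxZ; rewrite iter_psi_q; apply: inRx_psi; exact: zpunitX.
Qed.

Lemma inRx_ann x y (a : O) : inRx psi x y -> a *: x = 0 -> a *: y = 0.
Proof.
move=> [s [/allP su ->]] ax; rewrite scaler_sumr big_seq big1 // => u us.
rewrite scalerA mulrC -scalerA.
by rewrite -[a *: _](linearZZ (psi_linear (su _ us))) ax linear0 scaler0.
Qed.

(** Modulo p the block is (X^n - 1)^2 with n = (p-1) p^k, and by (c) psi_q^n - 1 already maps [y]
    into p R y. The last clause keeps track of torsion: if p^(t+1) kills [y], it kills [z], so p^t
    kills p z. *)
Lemma theta_block y : exists L, forall N, exists2 z,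
  pact (theta N (N + L)) y = p%:R *: z & forall a, a *: y = 0 -> a *: z = 0.
Proof.
have [_ _ /(_ 1%N isT)[k ck]] := proj2 psiB y.
exists (p.-1.*2 * p ^ k)%N => N.
set n := (p.-1 * p ^ k)%N.
have [z0 z0R Dy] : exists2 z, inRx psi y z & pact ('X^n - 1) y = p%:R *: z.
  have [] := ck (q%:Q ^+ n) 1 (zpunitX _ qU) zpunit1 _ y (inRx_self y).
    have [u eu _] := q_pow_lift p_pr p_odd q_prim k.
    (* [q_pow_lift] gives q^n = 1 + p^(k+1) u, one power of p more than (c) asks for. *)
    have -> : (q%:Q ^+ n - 1) / p%:Q ^+ k = zval (p%:R * u).
      have := congr1 (@zval p) eu.
      rewrite !(zvalX, zvalD, zvalM) zval_int zval1 !zval_nat => ->.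
      have p0 : (p%:Q : rat) != 0 by rewrite intr_eq0 -lt0n prime_gt0.
      by rewrite -pmulrn in p0 *; rewrite exprS; field; rewrite expf_neq0.
    exact: zvalP.
  move=> z [zR e]; exists z => //; rewrite expn1 in e.
  by rewrite -e poly_actDl -polyCN poly_actC scaleN1r poly_actXn iter_psi_q psi1.
have [|S eS] := @poly_residue_eq _ p_pr (theta N (N + p.-1.*2 * p ^ k)) (('X^n - 1) ^+ 2).
  rewrite (residue_theta p_pr p_odd q_prim) rmorphXn; congr (_ ^+ 2).
  by rewrite [RHS]rmorphB rmorph1; congr (_ - _); rewrite [RHS]map_polyXn.
exists (pact ('X^n - 1) z0 + pact S y).
  rewrite eS poly_actDl expr2 poly_actM Dy poly_actZr scalerDr; congr (_ + _).
  by rewrite -mul_polyC poly_actM poly_actC.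
move=> a ay; rewrite scalerDr -!poly_actZr ay (inRx_ann z0R ay).
by rewrite !poly_act0r addr0.
Qed.

(** Each block from [theta_block] lowers the torsion exponent by one. The start [N] is free, so that
    these factors can follow those of a given [theta 0 n]. *)
Lemma theta_kills_torsion t N y : p%:R ^+ t *: y = 0 ->
  exists2 b, (N <= b)%N & pact (theta N b) y = 0.
Proof.
elim: t N y => [|t IH] N y.
  by rewrite expr0 scale1r => ->; exists N => //; rewrite poly_act0r.
move=> py; have [L HL] := theta_block y; have [z ez zy] := HL N.
have [|b Nb eb] := IH (N + L)%N (pact (theta N (N + L)) y).
  by rewrite ez scalerA -exprSr zy.
exists b; first exact: leq_trans (leq_addr _ _) Nb.
by rewrite (theta_cat _ _ (leq_addr L N) Nb) mulrC poly_actM eb.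
Qed.

(** The part of the annihilating integer prime to p is invertible in Z_(p). *)
Lemma torsion_pow (y : M) : torsion y -> exists t, p%:R ^+ t *: y = 0.
Proof.
move=> [n [n0 ny]].
have nO : (n%:R : O) != 0.
  apply/eqP => /(congr1 (@zval p))/eqP.
  by rewrite zval_nat zval0 pnatr_eq0 (gtn_eqF n0).
have [u [u' [uu' en]]] := Zpl_valE p_pr nO.
move: (Zpl_val _) en => v en; exists v.
have -> : p%:R ^+ v = u' * n%:R :> O.
  by rewrite en mulrCA [u' * u]mulrC uu' mulr1.
by rewrite -scalerA ny scaler0.
Qed.

Lemma torsionD (y z : M) : torsion y -> torsion z -> torsion (y + z).
Proof.
move=> [n [n0 ny]] [m [m0 mz]]; exists (n * m)%N.
rewrite muln_gt0 n0 scalerDr; split=> //.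
rewrite {2}natrM -[(_ * _) *: z]scalerA mz scaler0 addr0.
by rewrite mulnC natrM -scalerA ny scaler0.
Qed.

Lemma torsion_pact (y : M) P : torsion y -> torsion (pact P y).
Proof.
by move=> [n [n0 ny]]; exists n; split=> //; rewrite -poly_actZr ny poly_act0r.
Qed.

Lemma theta_torsion_mono (y : M) n m : (n <= m)%N ->
  torsion (pact (theta 0 n) y) -> torsion (pact (theta 0 m) y).
Proof.
by move=> nm; rewrite (theta_cat _ _ (leq0n n) nm) mulrC poly_actM; exact: torsion_pact.
Qed.

(** By (b) for q, a nonzero multiple of [x] is, up to torsion, a finite sum of eigenvectors for
    powers of q. Each such power is a node, whose factor kills the eigenvector up to torsion. *)
Lemma theta_torsion x : exists n, torsion (pact (theta 0 n) x).
Proof.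
have [_ /(_ _ qU x (inRx_self x))[c [c0 [ys [ysP ty]]]] _] := proj2 psiB x.
have [n tn] : exists n, torsion (pact (theta 0 n) (\sum_(u <- ys) u.1)).
  elim: ys ysP {ty} => [|u ys IH] ysP.
    by exists 0; rewrite big_nil poly_act0r; exists 1%N; rewrite scaler0.
  have [|n tn] := IH; first by move=> v vs; apply: ysP; rewrite inE vs orbT.
  have [_ tu] := ysP u (mem_head _ _).
  have [i ei] := node_exp_surj u.2.
  exists (maxn n i.+1); rewrite big_cons poly_actDr; apply: torsionD; last first.
    exact: theta_torsion_mono (leq_maxl _ _) tn.
  apply: theta_torsion_mono (leq_maxr _ _) _.
  rewrite theta_recr // poly_actM; apply: torsion_pact.
  rewrite poly_actDl -polyCN poly_actC scaleNr /node ei.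
  by rewrite -['X]expr1 poly_actXn.
exists n; have := torsionD (torsion_pact (theta 0 n) ty) tn.
rewrite -poly_actDr subrK poly_actZr => -[m [m0 e]].
by exists (m * c)%N; rewrite muln_gt0 m0 c0 natrM -scalerA.
Qed.

(** The factors below [n] make [x] torsion, and those from [n] to [b] kill the result. The equality
    is boolean so that [ex_minn] can select the least such number in [depth]. *)
Lemma theta_kills x : exists n, pact (theta 0 n) x == 0.
Proof.
have [n /torsion_pow[t pt]] := theta_torsion x.
have [b nb eb] := theta_kills_torsion n pt.
by exists b; rewrite (theta_cat _ _ (leq0n n) nb) mulrC poly_actM eb.
Qed.

End Bousfield.

(** * The action of A *)

Section Operations.
Variables (p : nat) (q : int) (M : lmodType (Zpl p)) (psi : rat -> M -> M).
Hypothesis p_pr : prime p.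
Hypothesis p_odd : odd p.
Hypothesis q_prim : primitive_mod q (p ^ 2).
Hypothesis psiB : Bousfield_module psi.
Local Notation O := (Zpl p).
Local Notation qO := (q%:~R : O).
Local Notation node := (@node p q).
Local Notation theta := (@theta p q).
Local Notation pact := (poly_act (psi_q p_pr q_prim psiB)).

Let qU := zpunit_q p_pr q_prim.

(** [node i] is the eigenvalue of Psi^q on pi_(2k) for k = [node_exp i], so P(Psi^q) and [f] agree
    on these coefficient groups. *)
Definition interpolates (f : int -> rat) n (P : {poly O}) :=
  forall i, (i < n)%N -> zval P.[node i] = f (node_exp i).

Lemma interpolates_leq f m n P : (m <= n)%N ->
  interpolates f n P -> interpolates f m P.
Proof. by move=> mn fP i im; apply: fP; exact: leq_trans mn. Qed.

Lemma theta_kills_leq n m x : (n <= m)%N ->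
  pact (theta 0 n) x = 0 -> pact (theta 0 m) x = 0.
Proof.
by move=> nm e; rewrite (theta_cat _ _ (leq0n n) nm) mulrC poly_actM e poly_act0r.
Qed.

(** The difference of the polynomials is a multiple of [theta 0 n], which kills [x]. *)
Lemma pact_eq n x P Q : pact (theta 0 n) x = 0 ->
  (forall i, (i < n)%N -> P.[node i] = Q.[node i]) -> pact P x = pact Q x.
Proof.
move=> kx ePQ; have [|S eS] := @theta_dvd _ _ p_pr p_odd q_prim n (P - Q).
  by move=> i lt_in; rewrite hornerD hornerN ePQ // subrr.
by rewrite -[P](subrK Q) eS poly_actDl poly_actM kx poly_act0r add0r.
Qed.

Definition depth x : nat := ex_minn (theta_kills p_pr p_odd q_prim psiB x).

Lemma depth_kills x : pact (theta 0 (depth x)) x = 0.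
Proof. by rewrite /depth; case: ex_minnP => n /eqP. Qed.

Lemma depth_leq x n : pact (theta 0 n) x = 0 -> (depth x <= n)%N.
Proof. by rewrite /depth; case: ex_minnP => m _ mmin /eqP; exact: mmin. Qed.

(* Arbitrary when no polynomial interpolates [f]; this never happens for [f] in A. *)
Definition op_act (f : int -> rat) (x : M) : M :=
  pact (ClassicalEpsilon.epsilon (inhabits 0) (interpolates f (depth x))) x.

(** Removes the choice from [op_act]: [depth x] is the least bound, so [P] agrees at the nodes below
    it with the chosen polynomial. *)
Lemma op_actE f x n P : pact (theta 0 n) x = 0 -> interpolates f n P ->
  op_act f x = pact P x.
Proof.
move=> kx fP; have fP' := interpolates_leq (depth_leq kx) fP.
apply: (pact_eq (depth_kills x)) => i id; apply: zval_inj; rewrite fP' //.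
apply: (ClassicalEpsilon.epsilon_spec (inhabits 0) (interpolates f (depth x))) => //.
by exists P.
Qed.

Definition newton_sum (b : nat -> O) n : {poly O} := \sum_(i < n) b i *: theta 0 i.

Lemma zval_newton_sum b n x :
  zval (newton_sum b n).[x] = \sum_(i < n) zval (b i) * Theta q i (zval x).
Proof.
rewrite /newton_sum; elim: n => [|n IH]; first by rewrite !big_ord0 horner0 zval0.
rewrite !big_ord_recr /= hornerD hornerZ zvalD IH zvalM.
by rewrite (zval_theta p_pr q_prim).
Qed.

Lemma Theta_sum_trunc (a : nat -> rat) n m i : (i < n)%N -> (n <= m)%N ->
  \sum_(l < m) a l * Theta q l (q%:Q ^ node_exp i) =
  \sum_(l < n) a l * Theta q l (q%:Q ^ node_exp i).
Proof.
move=> lt_in nm; pose F l := a l * Theta q l (q%:Q ^ node_exp i).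
rewrite -!(big_mkord xpredT F).
rewrite (big_cat_nat (n := n)) //= [X in _ + X = _]big_nat.
rewrite [X in _ + X = _]big1 ?addr0 // => l /andP[nl _].
by rewrite /F (Theta_node_eq0 p_pr q_prim) ?mulr0 // (leq_trans lt_in).
Qed.

(** Terms of index at least [n] vanish at the first [n] nodes, so the truncated series has the right
    values there. *)
Lemma represents_interpolates a f n : represents p q a f ->
  interpolates f n (newton_sum (fun i => toZpl p (a i)) n).
Proof.
move=> af i lt_in; have [ap /(_ (node_exp i))[N eN]] := af.
rewrite (eN (maxn N n)) ?leq_maxl // (Theta_sum_trunc _ lt_in (leq_maxr _ _)).
rewrite zval_newton_sum (zval_node p_pr q_prim).
by apply: eq_bigr => l _; rewrite toZplK.
Qed.

Lemma inA_interpolates f n : inA p q f -> exists P, interpolates f n P.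
Proof. by move=> [a /represents_interpolates h]; eexists; exact: h. Qed.

Lemma op_act_Amodule : is_Amodule q op_act.
Proof.
split.
(* A common bound lets one polynomial compute the action on [x], [y] and [x + y]. *)
- move=> f fA x y; pose n := maxn (depth x) (depth y).
  have kx := theta_kills_leq (leq_maxl _ _ : (_ <= n)%N) (depth_kills x).
  have ky := theta_kills_leq (leq_maxr _ _ : (_ <= n)%N) (depth_kills y).
  have [P fP] := inA_interpolates n fA.
  by rewrite !(op_actE (n := n) (P := P)) ?poly_actDr ?kx ?ky ?addr0.
- move=> f g fA gA x; have kx := depth_kills x.
  have [P fP] := inA_interpolates (depth x) fA.
  have [Q gQ] := inA_interpolates (depth x) gA.
  rewrite (op_actE kx fP) (op_actE kx gQ) -poly_actDl; apply: (op_actE kx) => i id.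
  by rewrite hornerD zvalD fP // gQ.
- move=> f g fA gA x; have kx := depth_kills x.
  have [P fP] := inA_interpolates (depth x) fA.
  have [Q gQ] := inA_interpolates (depth x) gA.
  (* Polynomials in psi_q commute, so [theta 0 (depth x)] also kills [pact Q x] and [P] computes the
     action of [f] on it. *)
  rewrite (op_actE kx gQ) (op_actE _ fP) -?poly_actM; last first.
    by rewrite mulrC poly_actM kx poly_act0r.
  by apply: (op_actE kx) => i id; rewrite hornerM zvalM fP // gQ.
- move=> x; rewrite (op_actE (P := 1) (depth_kills x)) ?poly_act1l // => i _.
  by rewrite hornerC zval1.
Qed.

Lemma op_act_discrete : discrete_A q op_act.
Proof.
move=> x; exists (depth x) => f [a [a0 af]].
have fP := @represents_interpolates _ _ (depth x) af.
rewrite (op_actE (depth_kills x) fP) /newton_sum big1 ?poly_act0l // => i _.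
by rewrite a0 // -(zval0 p) zvalK scale0r.
Qed.

(** For q^e close to j, X^e nearly interpolates Psi^j. The errors at the nodes are divisible by
    p^(C+m), so [interpolation] corrects them by a polynomial divisible by p^m. *)
Lemma psi_approx j n m x : zpunit p j -> (0 < m)%N -> exists P z,
  [/\ interpolates (Psi j) n P, inRx psi x z & psi j x - pact P x = p%:R ^+ m *: z].
Proof.
move=> ju m0; have [C HC] := interpolation p_pr p_odd q_prim n.
have [_ _ /(_ m m0)[k ck]] := proj2 psiB x.
(* [k] is the accuracy needed to apply (c) to j and q^e, and [C + m] the one needed to correct the
   values at the nodes. *)
pose K := maxn k (C + m).
have [e [w ew]] := q_dense p_odd q_prim K (residue_zpunit p_pr ju).
have qeU := zpunitX e qU.
have p0 : (p%:R : rat) != 0 by rewrite pnatr_eq0 -lt0n prime_gt0.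
have jq l : (l <= K)%N -> (j - q%:Q ^+ e) / p%:R ^+ l \in zploc p.
  move=> lK; have -> : (j - q%:Q ^+ e) / p%:R ^+ l = zval (p%:R ^+ (K.+1 - l) * w).
    have /(congr1 (@zval p)) := ew.
    rewrite toZplK; last by case/and3P: ju.
    rewrite !(zvalD, zvalM, zvalX) zval_int zval_nat => ->.
    rewrite addrC addKr mulrAC; congr (_ * _).
    by rewrite -{1}(subnK (leqW lK)) exprD mulfK // expf_neq0.
  exact: zvalP.
have xx := inRx_self p_pr q_prim psiB x.
have [z0 [z0R ez0]] := ck _ _ ju qeU (jq k (leq_maxl _ _)) x xx.
pose f i := toZpl p ((j ^ node_exp i - (q%:Q ^+ e) ^ node_exp i) / p%:R ^+ (C + m)).
have [P HP] := HC f.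
exists ('X^e + (p%:R ^+ m)%:P * P), (z0 - pact P x); split.
- move=> i lt_in; rewrite hornerD hornerXn hornerM hornerC HP // zvalD zvalX.
  rewrite (zval_node p_pr q_prim) !zvalM !zvalX !zval_nat mulrA -exprD addnC.
  rewrite toZplK; last exact: zpow_congr (jq _ (leq_maxr _ _)).
  rewrite mulrC divfK ?expf_neq0 // !exprnP !exprz_exp [_ * Posz e]mulrC.
  by rewrite addrC subrK.
- by rewrite -scaleN1r; apply: inRxD => //; apply: inRxZ; exact: inRx_pact.
- rewrite poly_actDl poly_actXn iter_psi_q poly_actM poly_actC opprD addrA ez0.
  by rewrite natrX scalerBr.
Qed.

(** The approximations for different m interpolate the same values and so act alike on [x]. The
    error thus lies in p^m R x for all m, and vanishes since R x is finitely generated by (a). *)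
Lemma op_act_extends : extends_R psi op_act.
Proof.
move=> j ju x; pose n := depth x; have kx := depth_kills x.
have [P [z1 [jP z1R ez1]]] := psi_approx n x ju (ltn0Sn 0).
rewrite (op_actE kx jP); apply/esym/eqP; rewrite -subr_eq0; apply/eqP.
have [[s [sR sE]] _ _] := proj2 psiB x.
apply: (Krull_intersection p_pr (s := fun i : 'I_(size s) => s`_i)) => m.
have [z zR ->] : exists2 z, inRx psi x z & psi j x - pact P x = p%:R ^+ m *: z.
  (* [psi_approx] requires a positive exponent; level 0 reuses the approximation at level 1. *)
  case: m => [|m].
    by exists (p%:R ^+ 1 *: z1); [exact: inRxZ | rewrite expr0 scale1r].
  have [Q [z [jQ zR ez]]] := psi_approx n x ju (ltn0Sn m); exists z; rewrite // -ez.
  congr (_ - _); apply: (pact_eq kx) => i id; apply: zval_inj.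
  by rewrite jP // jQ.
by have [c ->] := sE z zR; exists (fun i => c i).
Qed.

(** * Polynomials in Psi^q as elements of A *)

Definition poly_op (P : {poly O}) : int -> rat :=
  fun k => zval P.[toZpl p (q%:Q ^ k)].

Lemma poly_opE b n : represents p q (fun i => if (i < n)%N then zval (b i) else 0)
  (poly_op (newton_sum b n)).
Proof.
split=> [i|k]; first by case: ifP => _; [exact: zvalP | exact: rpred0].
exists n => N nN; rewrite /poly_op zval_newton_sum (zval_zpow _ qU).
rewrite (big_ord_widen N (fun i => zval (b i) * Theta q i (q%:Q ^ k))) //.
by rewrite big_mkcond; apply: eq_bigr => i _; case: ifP; rewrite ?mul0r.
Qed.

Lemma inA_newton_sum b n : inA p q (poly_op (newton_sum b n)).
Proof. by eexists; exact: poly_opE. Qed.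

Lemma inA_polyC c : inA p q (poly_op c%:P).
Proof.
have -> : c%:P = newton_sum (fun=> c) 1.
  by rewrite /newton_sum big_ord1 /theta big_nil alg_polyC.
exact: inA_newton_sum.
Qed.

Lemma inA_XsubC c : inA p q (poly_op ('X - c%:P)).
Proof.
(* Newton expansion: X - c = (t_0 - c) Theta_0 + Theta_1. *)
have -> : 'X - c%:P = newton_sum (fun i => if i is 0 then node 0 - c else 1) 2.
  rewrite /newton_sum !big_ord_recr big_ord0 /= add0r /theta big_nil big_nat1.
  by rewrite scale1r alg_polyC polyCB addrC addrA subrK.
exact: inA_newton_sum.
Qed.

Lemma inA_X : inA p q (poly_op 'X).
Proof. by have := inA_XsubC 0; rewrite subr0. Qed.

Lemma inA_theta n : inA p q (poly_op (theta 0 n)).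
Proof.
have -> : theta 0 n = newton_sum (fun i => if i == n then 1 else 0) n.+1.
  rewrite /newton_sum big_ord_recr /= eqxx scale1r big1 ?add0r // => i _.
  by rewrite ltn_eqF ?scale0r.
exact: inA_newton_sum.
Qed.

Lemma poly_opD P Q : poly_op (P + Q) = fun k => poly_op P k + poly_op Q k.
Proof.
by apply: FunctionalExtensionality.functional_extensionality => k;
  rewrite /poly_op hornerD zvalD.
Qed.

Lemma poly_opM P Q : poly_op (P * Q) = fun k => poly_op P k * poly_op Q k.
Proof.
by apply: FunctionalExtensionality.functional_extensionality => k;
  rewrite /poly_op hornerM zvalM.
Qed.

Lemma poly_opX : poly_op 'X = Psi q%:Q.
Proof.
by apply: FunctionalExtensionality.functional_extensionality => k;
  rewrite /poly_op hornerX (zval_zpow _ qU).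
Qed.

(** * Uniqueness of the discrete action *)

Section Uniqueness.
Variable act : (int -> rat) -> M -> M.
Hypothesis actA : is_Amodule q act.
Hypothesis actR : extends_R psi act.

Lemma act_polyD P Q x : inA p q (poly_op P) -> inA p q (poly_op Q) ->
  act (poly_op (P + Q)) x = act (poly_op P) x + act (poly_op Q) x.
Proof. by case: actA => _ H _ _ PA QA; rewrite poly_opD H. Qed.

Lemma act_polyM P Q x : inA p q (poly_op P) -> inA p q (poly_op Q) ->
  act (poly_op (P * Q)) x = act (poly_op P) (act (poly_op Q) x).
Proof. by case: actA => _ _ H _ PA QA; rewrite poly_opM H. Qed.

Lemma act_poly1 x : act (poly_op 1) x = x.
Proof.
case: actA => _ _ _ H; rewrite -[RHS]H; congr (act _ x).
by apply: FunctionalExtensionality.functional_extensionality => k;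
  rewrite /poly_op hornerC zval1.
Qed.

(* [is_Amodule] does not mention the Z_(p)-scalars: the action of integers is
   forced by additivity, that of fractions because denominators are units. *)
Lemma act_polyC c x : act (poly_op c%:P) x = c *: x.
Proof.
pose h (c : O) := act (poly_op c%:P) x - c *: x.
have hD (a b : O) : h (a + b) = h a + h b.
  by rewrite /h polyCD (act_polyD _ (inA_polyC a) (inA_polyC b)) scalerDl opprD addrACA.
have h1 : h 1 = 0 by rewrite /h act_poly1 scale1r subrr.
have h0 : h 0 = 0 by apply: (addIr (h 0)); rewrite -hD !add0r.
have hN (a : O) : h (- a) = - h a by apply: (addIr (h a)); rewrite -hD !addNr.
have hMn (a : O) n : h (a *+ n) = h a *+ n.
  by elim: n => [|n IH]; rewrite ?mulr0n // !mulrS hD IH.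
have hMz (a : O) (n : int) : h (a * n%:~R) = h a *~ n.
  by case: n => n; rewrite ?NegzE ?mulrNz ?mulrN ?hN mulr_natr hMn.
suff : h c = 0 by move/eqP; rewrite subr_eq0 => /eqP.
have d0 := zvalP c.
have hd : h c *~ denq (zval c) = 0.
  rewrite -hMz; have -> : c * (denq (zval c))%:~R = 1 * (numq (zval c))%:~R :> O.
    by apply: zval_inj; rewrite !zvalM zval1 mul1r !zval_int zval_denq.
  by rewrite hMz h1 mul0rz.
rewrite -[LHS]scale1r.
have <- : toZpl p (1%:~R / (denq (zval c))%:~R) *
    toZpl p ((denq (zval c))%:~R / 1%:~R) = 1.
  by apply: Zpl_unit_frac; rewrite ?coprimen1 ?denq_neq0.
rewrite -scalerA; have -> : toZpl p ((denq (zval c))%:~R / 1%:~R) = (denq (zval c))%:~R.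
  by rewrite divr1 -(zval_int p) zvalK.
by rewrite scaler_int hd scaler0.
Qed.

Lemma act_XsubC c x : act (poly_op ('X - c%:P)) x = pact ('X - c%:P) x.
Proof.
rewrite -polyCN (act_polyD _ inA_X (inA_polyC _)) act_polyC poly_opX actR ?qU //.
by rewrite poly_actDl poly_actC -['X]expr1 poly_actXn.
Qed.

Lemma act_theta n x : act (poly_op (theta 0 n)) x = pact (theta 0 n) x.
Proof.
elim: n x => [|n IH] x; first by rewrite /theta big_nil act_poly1 poly_act1l.
rewrite theta_recr // mulrC (act_polyM _ (inA_XsubC _) (inA_theta n)).
by rewrite act_XsubC IH poly_actM.
Qed.

Lemma act_newton_sum b n x :
  act (poly_op (newton_sum b n)) x = pact (newton_sum b n) x.
Proof.
elim: n => [|n IH].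
  by rewrite /newton_sum big_ord0 poly_act0l -[0]/(0%:P) act_polyC scale0r.
have -> : newton_sum b n.+1 = newton_sum b n + (b n)%:P * theta 0 n.
  by rewrite /newton_sum big_ord_recr mul_polyC.
have bA : inA p q (poly_op ((b n)%:P * theta 0 n)).
  rewrite mul_polyC.
  have -> : b n *: theta 0 n = newton_sum (fun i => if i == n then b n else 0) n.+1.
    rewrite /newton_sum big_ord_recr /= eqxx big1 ?add0r // => i _.
    by rewrite ltn_eqF ?scale0r.
  exact: inA_newton_sum.
rewrite (act_polyD _ (inA_newton_sum b n) bA).
rewrite IH (act_polyM _ (inA_polyC _) (inA_theta n)) act_polyC act_theta.
by rewrite poly_actDl poly_actM poly_actC.
Qed.

(** Split [f] as its truncation [S] plus a remainder. Taking [n] at least [n0] puts the remainder in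
    A_(n0), which kills [x] by discreteness; taking it at least [depth x] makes [S] compute
    [op_act f x]. *)
Lemma op_act_unique : discrete_A q act -> forall f, inA p q f -> forall x,
  act f x = op_act f x.
Proof.
move=> actD f fA x; have [a af] := fA; have [n0 Hn0] := actD x.
pose n := maxn n0 (depth x); pose S := newton_sum (fun i => toZpl p (a i)) n.
have kx : pact (theta 0 n) x = 0 := theta_kills_leq (leq_maxr _ _) (depth_kills x).
rewrite (op_actE kx (@represents_interpolates _ _ n af)) -/S.
have rA : inAm p q n0 (fun k => f k - poly_op S k).
  exists (fun i => if (i < n)%N then 0 else a i); split=> [i im|].
    by rewrite (leq_trans im) ?leq_maxl.
  have [ap aN] := af; split=> [i|k]; first by case: ifP => // _; exact: rpred0.
  have [_ /(_ k)[N2 eN2]] := poly_opE (fun i => toZpl p (a i)) n.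
  have [N eN] := aN k; exists (maxn N N2) => N'.
  rewrite geq_max => /andP[le le2].
  rewrite (eN _ le) (eN2 _ le2) -sumrB; apply: eq_bigr => i _.
  by case: ifP => _; rewrite ?toZplK // ?subrr ?mul0r ?subr0.
have fE : f = fun k => poly_op S k + (f k - poly_op S k).
  by apply: FunctionalExtensionality.functional_extensionality => k; rewrite addrC subrK.
case: (actA) => _ actD' _ _; have [b [_ rb]] := rA.
rewrite {1}fE actD'; [|exact: inA_newton_sum|by exists b].
by rewrite (Hn0 _ rA) addr0 act_newton_sum.
Qed.

End Uniqueness.

End Operations.

Theorem theorem4p4 (p : nat) (q : int) (M : lmodType (Zpl p))
    (psi : rat -> M -> M) :
  prime p -> odd p -> primitive_mod q (p ^ 2) ->
  Bousfield_module psi ->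
  exists act : (int -> rat) -> M -> M,
    [/\ is_Amodule q act, extends_R psi act, discrete_A q act &
        forall act' : (int -> rat) -> M -> M,
          is_Amodule q act' -> extends_R psi act' -> discrete_A q act' ->
          forall f, inA p q f -> forall x, act' f x = act f x].
Proof.
move=> p_pr p_odd q_prim psiB; exists (op_act p_pr p_odd q_prim psiB); split.
- exact: op_act_Amodule.
- exact: op_act_extends.
- exact: op_act_discrete.
- by move=> act' actA actR actD f fA x; exact: op_act_unique.
Qed.
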